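(* Let $\ell$ and $m$ be positive integers such that $\ell\ge m$, and let $n$ be an integer with $$n\ge \max\left\{\ell+2,\ 3\ell+\left\lfloor\frac{\ell-m}{2}\right\rfloor-2m-2\right\}.$$ Then every graph obtained by the construction $\mathcal{C}_4(\ell,m;n)$ described in the context is a $K_{\ell,m,m}$-saturated subgraph of $K_{n,n,n}$, and thus $$\operatorname{sat}(K_{n,n,n},K_{\ell,m,m})\le 3(\ell+m)n-3\left(\ell-m-\left\lfloor\frac{\ell-m}{2}\right\rfloor\right)\left\lfloor\frac{\ell-m}{2}\right\rfloor-3\ell m-3.$$
   Context: All graphs are simple, and $[k]=\{1,\dots,k\}$. For graphs $F$ and $H$, a subgraph $G$ of $H$ (with $V(G)=V(H)$) is an $F$-saturated subgraph of $H$ if $G$ contains no copy of $F$ as a (not necessarily induced) subgraph, but $G+e$ contains a copy of $F$ for every $e\in E(H)\setminus E(G)$. The number $\operatorname{sat}(H,F)$ is the minimum number of edges in an $F$-saturated subgraph of $H$. The host graph $K_{n,n,n}$ is the complete tripartite graph with partite sets $V_1,V_2,V_3$, where $V_i=\{v_i^1,\dots,v_i^{n}\}$. The graph $K_{a,b,c}$ is the complete tripartite graph with part sizes $a,b,c$. Arithmetic in subscripts is modulo 3 (with values in $[3]$). Construction $\mathcal{C}_4(\ell,m;n)$: For each $i\in[3]$ let $S_i=\{v_i^1,\dots,v_i^m\}$ and join every vertex of $S_i$ to all vertices of $V_{i+1}\cup V_{i+2}$. Let $t=\lfloor(\ell-m)/2\rfloor$, and for each $i\in[3]$ let $T_i=\{v_i^{m+1},\dots,v_i^{m+t}\}$.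 For all $i\in[3]$, completely join $T_i$ to $T_{i+1}$. Let $\bigcup_{i\in[3]}(V_i\setminus(S_i\cup T_i))$ induce a triangle-free tripartite graph in which, for all $i\in[3]$, each vertex in $V_i\setminus(S_i\cup T_i)$ has exactly $\ell-m$ neighbors in each of $V_{i+1}\setminus(S_{i+1}\cup T_{i+1})$ and $V_{i+2}\setminus(S_{i+2}\cup T_{i+2})$. There are no other edges. Finally, delete the three edges $v_1^1v_2^1$, $v_1^1v_3^1$, $v_2^1v_3^1$. *)

(* Defs.v *)
From HB Require Import structures.
From mathcomp Require Import all_boot.

Set Implicit Arguments.
Unset Strict Implicit.
Unset Printing Implicit Defensive.

(** Finite simple graphs on the vertex set [V], given by their edge sets. *)
Record sgraph (V : finType) := SGraph {
  edges : {set {set V}};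
  edgesP : [forall e in edges, #|e| == 2] }.

HB.instance Definition _ (V : finType) := [isSub for @edges V].
HB.instance Definition _ (V : finType) := [Finite of sgraph V by <:].

Definition adj (V : finType) (G : sgraph V) : rel V :=
  [rel x y | [set x; y] \in edges G].

Lemma pairs_of_card2 (V : finType) (E : {set {set V}}) :
  [forall e in [set e in E | #|e| == 2], #|e| == 2].
Proof. by apply/forall_inP => e; rewrite inE => /andP[]. Qed.

(** Members of [E] that are not pairs of distinct vertices are discarded. *)
Definition graph_of (V : finType) (E : {set {set V}}) : sgraph V :=
  SGraph (pairs_of_card2 E).

Definition add_edge (V : finType) (G : sgraph V) (e : {set V}) : sgraph V :=
  graph_of (e |: edges G).

Definition contains (U V : finType) (F : sgraph U) (G : sgraph V) : bool :=
  [exists f : {ffun U -> V},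
    injectiveb f && [forall x, forall y, adj F x y ==> adj G (f x) (f y)]].

Definition triangle_free (V : finType) (G : sgraph V) : bool :=
  [forall x, forall y, forall z, ~~ [&& adj G x y, adj G y z & adj G x z]].

Definition saturated (U V : finType) (H : sgraph V) (F : sgraph U)
    (G : sgraph V) : bool :=
  [&& edges G \subset edges H, ~~ contains F G &
      [forall e in edges H :\: edges G, contains F (add_edge G e)]].

(** The default value [#|edges H|] bounds the size of every subgraph of [H], so
    it is relevant only if no saturated subgraph exists; by [sat_attained] this
    does not happen when [F] has an edge. *)
Definition sat (U V : finType) (H : sgraph V) (F : sgraph U) : nat :=
  \big[minn/#|edges H|]_(G : sgraph V | saturated H F G) #|edges G|.

Lemma sat_le (U V : finType) (H : sgraph V) (F : sgraph U) (G : sgraph V) :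
  saturated H F G -> sat H F <= #|edges G|.
Proof.
move=> satG; rewrite /sat -big_filter.
have: G \in [seq K <- index_enum (sgraph V) | saturated H F K].
  by rewrite mem_filter satG mem_index_enum.
elim: [seq _ <- _ | _] => //= K s IHs; rewrite inE big_cons geq_min.
by case/predU1P=> [->|/IHs ->]; rewrite ?leqnn ?orbT.
Qed.

Lemma sat_attained (U V : finType) (H : sgraph V) (F : sgraph U) :
  edges F != set0 ->
  exists2 G : sgraph V, saturated H F G & sat H F = #|edges G|.
Proof.
move=> /set0Pn[e0 e0F].
have [G satG]: exists G : sgraph V, saturated H F G.
  pose P (G : sgraph V) := (edges G \subset edges H) && ~~ contains F G.
  have P0 : P (graph_of set0).
    rewrite /P; apply/andP; split.
      by apply/subsetP => e; rewrite !inE.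
    apply/existsP => -[f /andP[_ /forallP/= homf]].
    have/forall_inP/(_ e0 e0F) e0_2 := edgesP F.
    have /cards2P[x [y [_ e0E]]] := e0_2.
    have /forallP/(_ y)/implyP := homf x.
    by rewrite /adj /= -e0E e0F !inE andFb => /(_ isT).
  case: (arg_maxnP (fun G : sgraph V => #|edges G|) P0) => G /andP[GH nFG] maxG.
  exists G; rewrite /saturated GH nFG /=; apply/forall_inP => e.
  rewrite inE => /andP[eG eH]; apply: contraNT eG => nF.
  have e2 : #|e| == 2 by have /forall_inP/(_ _ eH) := edgesP H.
  have eE : edges (add_edge G e) = e |: edges G.
    apply/setP => e'; rewrite /= !inE; have [->|_] /= := eqVneq e' e; first by [].
    have [e'G|//] := boolP (e' \in _).
    by have /forall_inP/(_ _ e'G) := edgesP G.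
  have := maxG (add_edge G e); rewrite /P nF eE subUset sub1set eH GH => /(_ isT).
  by rewrite cardsU1; case: (e \in edges G) => //; rewrite add1n /= ltnn.
have := sat_le; rewrite /sat => satle.
case: (arg_minnP (fun K : sgraph V => #|edges K|) satG) => K satK minK.
exists K => //; apply/eqP; rewrite eqn_leq satle //=.
elim/big_rec: _ => [|L n satL nK]; last by rewrite leq_min nK minK.
by apply: subset_leq_card; case/and3P: satK.
Qed.

(** Complete multipartite graph whose parts are the fibres of [part]. *)
Definition multipartite (V : finType) (K : eqType) (part : V -> K) : sgraph V :=
  graph_of [set [set p.1; p.2] | p in [pred p : V * V | part p.1 != part p.2]].

(** [K_{a,b,c}]; vertices are pairs of a part [i] and an index below its size. *)
Definition part_size (a b c : nat) (i : 'I_3) : nat := nth 0 [:: a; b; c] i.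
Definition K3part (a b c : nat) : sgraph {i : 'I_3 & 'I_(part_size a b c i)} :=
  multipartite (fun x : {i : 'I_3 & 'I_(part_size a b c i)} => tag x).

(** Host [K_{n,n,n}]; [v_i^j] is the pair [(i - 1, j - 1)]. *)
Definition host_vertex (n : nat) : finType := ('I_3 * 'I_n)%type.
Definition host (n : nat) : sgraph (host_vertex n) :=
  multipartite (fun x : host_vertex n => x.1).

(** [{v_i^(a+1), ..., v_i^b}] *)
Definition block (n : nat) (i : 'I_3) (a b : nat) : {set host_vertex n} :=
  [set x : host_vertex n | (x.1 == i) && (a <= x.2 < b)].

Definition join (V : finType) (A B : {set V}) : {set {set V}} :=
  [set [set x; y] | x in A, y in B].

Section Construction.
Variables (l m n : nat).

Let t : nat := (l - m)./2.
Let P i := block n i 0 n.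
Let S i := block n i 0 m.
Let T i := block n i m (m + t).
Let R i := block n i (m + t) n.
Let first i := block n i 0 1.

(** The part of the construction outside the [S_i] and [T_i]; [ordS] is the
    cyclic successor of ['I_3]. *)
Definition C4_rest (Q : sgraph (host_vertex n)) : Prop :=
  [/\ edges Q \subset edges (host n),
      forall x y, adj Q x y -> x \in \bigcup_i R i,
      triangle_free Q &
      forall i x, x \in R i ->
        #|[set y in R (ordS i) | adj Q x y]| = l - m /\
        #|[set y in R (ordS (ordS i)) | adj Q x y]| = l - m].

Definition C4 (G : sgraph (host_vertex n)) : Prop :=
  exists2 Q : sgraph (host_vertex n), C4_rest Q &
    edges G =
      ((\bigcup_i join (S i) (P (ordS i) :|: P (ordS (ordS i)))) :|:
       (\bigcup_i join (T i) (T (ordS i))) :|: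
       edges Q) :\: \bigcup_i join (first i) (first (ordS i)).

End Construction.

(* Main.v *)
Require Import Defs.
From mathcomp Require Import all_boot ssralg zmodp zify.

Set Implicit Arguments.
Unset Strict Implicit.
Unset Printing Implicit Defensive.

(** Write [l = m + d]. In each part [V_i] call the first [m] vertices low, the
next [t] middle, and the others rest vertices; the first vertex of a part is
its origin. The low vertices are joined to everything outside their part, the
middle vertices of different parts are joined, the rest carries a triangle-free
graph [Q] in which each vertex has [d] neighbours in each of the two other
parts, and origins are pairwise non-adjacent. This is the relation [layered],
for an arbitrary [t]; the construction of the theorem is the case
[t = floor (d / 2)] ([C4_layered]).

Such a graph has no copy of [K_{m+d,m,m}] as soon as [t < d] or [t = 0]
([layered_free]). Each class of a copy lies in one part, and at most one class
contains an origin. A class without a non-low vertex has at least [m] elements,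
so it is the whole set of low vertices of its part and contains the origin. If
all three classes have non-low vertices, then each of these lies in a triangle
of non-low vertices, hence is a middle vertex; so [t > 0], and the large class
has at most [m + t < m + d] vertices. Otherwise one class consists of low
vertices, and one of the two others has [m + d] elements, since [d = 0] if the
low class is the large one. These two miss their origins, so that a non-low
vertex of the third class sees at least [(m + d) - (m - 1) = d + 1] non-low
vertices of that one, while a non-low vertex has at most [d] non-low neighbours
in each part.

Adding an edge creates a copy. If it joins two origins, then all low vertices
of their two parts together with the non-origins of the third part form a copy
([copy_at_origins]). Otherwise it joins a rest vertex [x] to a non-low vertex
[y], and the [d] rest neighbours of [x] in the part of [y], with [y] itself,
are the [d + 1] non-low vertices just excluded ([copy_at_rest]).

For the bound on [sat] a graph [Q] must be exhibited. With [N] rest vertices in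
each part it is a circulant graph on three copies of [Z/N] whose three
connection sets are progressions of length [d] and difference [q], the last
being shifted by [1], so that a triangle amounts to a multiple of [N] of the
form [q * k + 1] with [k <= 3 * (d - 1)] ([progression_rest]). With [q = 1]
this is impossible for [N >= 3 * d - 1], and with [q = 2] it is impossible for
even [N >= 2 * d]. The remaining case is [N = 3 * d - 2] with [d >= 3] odd. If
such an [N] is prime, then no circulant [Q] exists at all, by the
Cauchy-Davenport theorem. But the number of edges depends on [t] only through [t * (d - t)], so for odd
[d] the value [t = ceil (d / 2)] gives the same number of edges, and it leaves
the even number [3 * d - 3 >= 2 * d] of rest vertices ([exists_rest]). *)

(** * Graphs and their adjacency relations *)

Lemma eq_set2 (T : finType) (x y u v : T) :
  ([set x; y] == [set u; v]) =
  ((x == u) && (y == v)) || ((x == v) && (y == u)).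
Proof.
apply/eqP/idP => [E | /orP[]/andP[/eqP-> /eqP->] //]; last by rewrite setUC.
have memE z : (z == x) || (z == y) = (z == u) || (z == v).
  by move/setP/(_ z): E; rewrite !inE.
have := memE x; have := memE y; have := memE u; have := memE v.
rewrite !eqxx ?orbT (eq_sym u) (eq_sym v) (eq_sym u) (eq_sym v).
case: (x == u); case: (x == v); case: (y == u); case: (y == v) => //.
Qed.

Lemma adj_sym (V : finType) (G : sgraph V) : symmetric (adj G).
Proof. by move=> x y; rewrite /adj /= setUC. Qed.

Lemma adj_neq (V : finType) (G : sgraph V) x y : adj G x y -> x != y.
Proof.
by move=> /(forall_inP (edgesP G)); rewrite cards2; case: (x != y).
Qed.

Lemma edge_adj (V : finType) (G : sgraph V) e :
  e \in edges G -> exists x y, e = [set x; y] /\ adj G x y.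
Proof.
move=> eG; have /(forall_inP (edgesP G))/cards2P[x [y [_ E]]] := eG.
by exists x, y; split; rewrite // /adj /= -E.
Qed.

Lemma edges_subset (V : finType) (G H : sgraph V) :
  (forall x y, adj G x y -> adj H x y) -> edges G \subset edges H.
Proof.
by move=> GH; apply/subsetP => e /edge_adj[x [y [-> /GH]]].
Qed.

Definition rel_graph (V : finType) (r : rel V) : sgraph V :=
  graph_of [set [set p.1; p.2] | p in [pred p : V * V | r p.1 p.2]].

Lemma adj_rel_graph (V : finType) (r : rel V) x y :
  symmetric r -> adj (rel_graph r) x y = (x != y) && r x y.
Proof.
move=> r_sym; rewrite /adj /= inE cards2 andbC; case: (x =P y) => //= _.
apply/imsetP/idP => [[[u v]] /= | rxy]; last by exists (x, y).
rewrite inE /= => ruv /eqP; rewrite eq_set2.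
by case/orP=> /andP[/eqP-> /eqP->] //; rewrite r_sym.
Qed.

Lemma adj_multipartite (V : finType) (K : eqType) (part : V -> K) x y :
  adj (multipartite part) x y = (part x != part y).
Proof.
have -> : multipartite part = rel_graph [rel x y | part x != part y] by [].
rewrite adj_rel_graph /= => [|u v]; last by rewrite /= eq_sym.
by case: eqVneq => [->|]; rewrite ?eqxx.
Qed.

Lemma adj_add_edge (V : finType) (G : sgraph V) e x y :
  adj G x y -> adj (add_edge G e) x y.
Proof.
move=> Gxy; rewrite /adj /= !inE cards2 (adj_neq Gxy) andbT.
by apply/orP; right.
Qed.

Lemma adj_added_edge (V : finType) (G : sgraph V) x y :
  x != y -> adj (add_edge G [set x; y]) x y.
Proof. by move=> xy; rewrite /adj /= !inE cards2 xy eqxx. Qed.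

Lemma mem_join (V : finType) (A B : {set V}) x y :
  ([set x; y] \in join A B) =
  ((x \in A) && (y \in B)) || ((x \in B) && (y \in A)).
Proof.
apply/imset2P/idP => [[u v uA vB /eqP] | /orP[]/andP[xA yB]].
- rewrite eq_set2; case/orP=> /andP[/eqP-> /eqP->]; first by rewrite uA vB.
  by rewrite uA vB orbT.
- by exists x y.
- by exists y x; rewrite // setUC.
Qed.

(** * Copies of a complete tripartite graph *)

Definition completely_joined (V : finType) (G : sgraph V) (A B : {set V}) :=
  forall x y, x \in A -> y \in B -> adj G x y.

Lemma completely_joinedC (V : finType) (G : sgraph V) (A B : {set V}) :
  completely_joined G A B -> completely_joined G B A.
Proof. by move=> AB x y xB yA; rewrite adj_sym AB. Qed.

(** Different classes have disjoint images because adjacency is irreflexive. *)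
Lemma contains_K3part (V : finType) (G : sgraph V) (A B C : {set V}) a b c :
  a <= #|A| -> b <= #|B| -> c <= #|C| ->
  completely_joined G A B -> completely_joined G A C ->
  completely_joined G B C ->
  contains (K3part a b c) G.
Proof.
move=> aA bB cC AB AC BC.
pose s (i : 'I_3) : {set V} := nth set0 [:: A; B; C] i.
have s_size i : part_size a b c i <= #|s i|.
  by rewrite /s /part_size; case: i => [[|[|[|[]]]]].
have s_joined i j : i != j -> completely_joined G (s i) (s j).
  rewrite /s; case: i j => [[|[|[|//]]] i3] [[|[|[|//]]] j3] //= _;
  by try exact: completely_joinedC.
pose f (x : {i : 'I_3 & 'I_(part_size a b c i)}) : V :=
  enum_val (widen_ord (s_size (tag x)) (tagged x)).
have fP x : f x \in s (tag x) by apply: enum_valP.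
apply/existsP; exists (finfun f); apply/andP; split.
  apply/injectiveP => x y; rewrite !ffunE.
  have [xy|/s_joined] := eqVneq (tag x) (tag y); last first.
    by move/(_ _ _ (fP x) (fP y))/adj_neq/eqP.
  case: x y xy => [i x] [j y] /= ij; subst j.
  by move/enum_val_inj => /(congr1 val) /= xy; congr existT; apply: val_inj.
apply/forallP=> x; apply/forallP=> y; rewrite adj_multipartite !ffunE.
by apply/implyP => /s_joined; apply.
Qed.

Lemma third_part (i j : 'I_3) : exists k : 'I_3, (k != i) && (k != j).
Proof.
case: (pickP [pred k : 'I_3 | (k != i) && (k != j)]) => [k kP|none].
  by exists k.
have /subset_leq_card : [set: 'I_3] \subset [set i; j].
  apply/subsetP => k _; have /negbT := none k.
  by rewrite /= negb_and !negbK !inE.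
by rewrite cardsT card_ord cards2; case: (i != j).
Qed.

Lemma eq_third_part (i j k k' : 'I_3) :
  i != j -> k != i -> k != j -> k' != i -> k' != j -> k = k'.
Proof.
move=> ij ki kj k'i k'j; apply/val_inj/eqP => /=.
case: i j k k' ij ki kj k'i k'j => [[|[|[|//]]] ?] [[|[|[|//]]] ?];
by case=> [[|[|[|//]]] ?] [[|[|[|//]]] ?].
Qed.

Definition one_coloured (V : finType) (col : V -> 'I_3) (A : {set V}) :=
  {in A &, forall x y, col x = col y}.

(** A copy of a complete tripartite graph in a 3-coloured graph follows the
colouring: two vertices of one class have common neighbours of two different
colours in the other classes, which leaves a single colour for both. *)
Lemma K3part_copy (V : finType) (G : sgraph V) (col : V -> 'I_3) a b c :
  (forall x y, adj G x y -> col x != col y) -> 0 < a -> 0 < b -> 0 < c ->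
  contains (K3part a b c) G ->
  exists A B C : {set V},
    [/\ #|A| = a, #|B| = b & #|C| = c] /\
    [/\ one_coloured col A, one_coloured col B & one_coloured col C] /\
    [/\ completely_joined G A B, completely_joined G A C &
        completely_joined G B C].
Proof.
move=> colP a_gt0 b_gt0 c_gt0 /existsP[f /andP[/injectiveP f_inj f_adj]].
have {f_adj} f_adj x y : tag x != tag y -> adj G (f x) (f y).
  have /forallP/(_ x)/forallP/(_ y) := f_adj.
  by rewrite adj_multipartite => /implyP.
have size_gt0 i : 0 < part_size a b c i.
  by case: i => [[|[|[|//]]] ?].
pose vertices i : finType := 'I_(part_size a b c i).
pose s (i : 'I_3) := [set f (Tagged vertices k) | k : vertices i].
have s_card i : #|s i| = part_size a b c i.
  rewrite card_imset ?card_ord // => k k' /f_inj/eqP.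
  by rewrite eq_Tagged => /eqP.
have s_joined i j : i != j -> completely_joined G (s i) (s j).
  by move=> ij _ _ /imsetP[k _ ->] /imsetP[k' _ ->]; apply: f_adj.
have s_col i : one_coloured col (s i).
  move=> x y xi yi.
  have [j /andP[ji _]] := third_part i i.
  have [k /andP[ki kj]] := third_part i j.
  have [u uj] : exists u, u \in s j.
    by apply/set0Pn; rewrite -card_gt0 s_card.
  have [v vk] : exists v, v \in s k.
    by apply/set0Pn; rewrite -card_gt0 s_card.
  rewrite eq_sym in ji; rewrite eq_sym in ki; rewrite eq_sym in kj.
  by apply: (@eq_third_part (col u) (col v)); apply: colP;
    [apply: (s_joined j k) | apply: (s_joined i j) | apply: (s_joined i k)
    | apply: (s_joined i j) | apply: (s_joined i k)].
exists (s (inord 0)), (s (inord 1)), (s (inord 2)).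
have neq (i j : nat) : i < 3 -> j < 3 -> i != j -> inord i != inord j :> 'I_3.
  by move=> i3 j3; rewrite -val_eqE /= !inordK.
split; first by rewrite !s_card /part_size !inordK.
by split; split => //; apply/s_joined/neq.
Qed.

(** * Layered graphs *)

Lemma card_block n i a b : b <= n -> #|block n i a b| = b - a.
Proof.
move=> bn; have -> : block n i a b = setX [set i] [set k : 'I_n | a <= k < b].
  by apply/setP => x; rewrite !inE.
rewrite cardsX cards1 mul1n cardsE -sum1_card.
rewrite -(big_mkord (fun k => a <= k < b) (fun=> 1)).
rewrite -(big_nat_widen 0 b n (leq a) (fun=> 1)) //.
have /= <- := @big_nat_widenl _ 0 addn a 0 b xpredT (fun=> 1) (leq0n a).
by rewrite sum_nat_const_nat muln1.
Qed.

Lemma host_vertex_eq n (x y : host_vertex n) :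
  x.1 = y.1 -> x.2 = y.2 :> nat -> x = y.
Proof. by case: x y => [i k] [j h] /= -> kh; congr pair; apply: val_inj. Qed.

(** The rest of the construction, placed on the vertices of index at least
[off] in each part, as a relation. *)
Record rest (n off d : nat) (Q : rel (host_vertex n)) : Prop := Rest {
  rest_sym : symmetric Q;
  rest_out : forall x y, Q x y -> [/\ off <= x.2, off <= y.2 & x.1 != y.1];
  rest_triangle_free : forall x y z, Q x y -> Q y z -> ~~ Q x z;
  rest_degree : forall (x : host_vertex n) j, off <= x.2 -> x.1 != j ->
    #|[set y : host_vertex n | (y.1 == j) && Q x y]| = d }.

Definition layered n m t (Q : rel (host_vertex n)) : rel (host_vertex n) :=
  [rel x y : host_vertex n | [&& x.1 != y.1, (0 < x.2) || (0 < y.2) &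
    [|| x.2 < m, y.2 < m, (x.2 < m + t) && (y.2 < m + t) | Q x y]]].

Lemma layeredE n m t (Q : rel (host_vertex n)) x y : layered m t Q x y =
  [&& x.1 != y.1, (0 < x.2) || (0 < y.2) &
    [|| x.2 < m, y.2 < m, (x.2 < m + t) && (y.2 < m + t) | Q x y]].
Proof. by []. Qed.

Section Layered.

Variables (n m t d : nat) (Q : rel (host_vertex n)).
Variable G : sgraph (host_vertex n).
Hypotheses (m_gt0 : 0 < m) (mdn : m + d < n) (td : 0 < t -> t < d).
Hypotheses (restQ : rest (m + t) d Q) (adjG : adj G =2 layered m t Q).

Let t_le_d : t <= d. Proof. by case: (t) td => // t' /(_ isT)/ltnW. Qed.

Lemma layered_partite x y : adj G x y -> x.1 != y.1.
Proof. by rewrite adjG layeredE => /and3P[]. Qed.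

(** A middle vertex sees the [t <= d] middle vertices of another part, and a
rest vertex sees [d] rest vertices there. *)
Lemma high_degree (y : host_vertex n) i : m <= y.2 -> y.1 != i ->
  #|[set x in block n i m n | adj G y x]| <= d.
Proof.
move=> y_high yi; have [y_mid|y_rest] := ltnP y.2 (m + t).
  apply: (@leq_trans #|block n i m (m + t)|); last by rewrite card_block; lia.
  apply/subset_leq_card/subsetP => x; rewrite !inE adjG layeredE.
  case/andP=> /and3P[-> x_high _].
  case/and3P=> _ _; rewrite !ltnNge y_high x_high /= -!ltnNge.
  by case/orP=> [/andP[] // | /(rest_out restQ)[]]; lia.
rewrite -(rest_degree restQ y_rest yi).
apply/subset_leq_card/subsetP => x; rewrite !inE adjG layeredE.
case/andP=> /and3P[-> x_high _].
by case/and3P=> _ _; rewrite !ltnNge y_high x_high y_rest.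
Qed.

Definition in_part (i : 'I_3) (A : {set host_vertex n}) :=
  forall x : host_vertex n, x \in A -> x.1 = i.

Definition origin (i : 'I_3) : host_vertex n :=
  (i, Ordinal (leq_ltn_trans (leq0n _) mdn)).

Lemma full_bottom i (A : {set host_vertex n}) :
  in_part i A -> m <= #|A| ->
  (forall x : host_vertex n, x \in A -> x.2 < m) -> origin i \in A.
Proof.
move=> Ai mA A_low; suff -> : A = block n i 0 m by rewrite !inE /= eqxx.
apply/eqP; rewrite eqEcard card_block; last lia.
rewrite subn0 mA andbT; apply/subsetP => x xA.
by rewrite inE (Ai _ xA) eqxx A_low.
Qed.

(** This is where deleting the edges between origins takes effect: without its
origin, a part has only [m - 1] low vertices, so that [A] needs one more
non-low vertex. *)
Lemma card_without_origin i (A : {set host_vertex n}) :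
  in_part i A -> origin i \notin A -> #|A| < m + #|A :&: block n i m n|.
Proof.
move=> Ai A0; have -> : #|A| = #|A :&: block n i m n| + #|A :\: block n i m n|.
  by rewrite cardsID.
suff : #|A :\: block n i m n| <= #|block n i 1 m| by rewrite card_block; lia.
apply/subset_leq_card/subsetP => x; rewrite !inE => /andP[+ xA].
rewrite (Ai _ xA) eqxx ltn_ord andbT /= -ltnNge => ->; rewrite andbT lt0n.
apply: contraNneq A0 => x0; suff <- : x = origin i by [].
by apply: host_vertex_eq => //; apply: Ai.
Qed.

(** The set [C] is forced to contain an origin, which excludes the origins of
the two other parts; then [A] has [d + 1] non-low vertices, too many for a
non-low vertex of [B]. *)
Lemma no_joined_to_bottom a b c (A B C : {set host_vertex n}) :
  in_part a A -> in_part b B -> in_part c C ->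
  m + d <= #|A| -> m <= #|B| -> m <= #|C| ->
  completely_joined G A B -> completely_joined G A C ->
  completely_joined G B C ->
  (forall x : host_vertex n, x \in C -> x.2 < m) -> False.
Proof.
move=> Aa Bb Cc lA mB mC AB AC BC /(full_bottom Cc mC) C0.
have origins i j : adj G (origin i) (origin j) = false.
  by rewrite adjG layeredE andbF.
have A0 : origin a \notin A by apply/negP => /AC/(_ C0); rewrite origins.
have B0 : origin b \notin B by apply/negP => /BC/(_ C0); rewrite origins.
have [y] : exists y, y \in B :&: block n b m n.
  by apply/set0Pn; rewrite -card_gt0; have := card_without_origin Bb B0; lia.
rewrite in_setI inE => /andP[yB /and3P[_ y_high _]].
suff : #|A :&: block n a m n| <= d by have := card_without_origin Aa A0; lia.
have [x xA] : exists x, x \in A by apply/set0Pn; rewrite -card_gt0; lia.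
have ya : y.1 != a by rewrite -(Aa _ xA) layered_partite // adj_sym AB.
apply: leq_trans (high_degree y_high ya).
apply/subset_leq_card/subsetP => u /setIP[uA ub].
by rewrite inE ub adj_sym AB.
Qed.

(** The middle and rest vertices are not adjacent, and the rest has no
triangle. *)
Lemma high_triangle (x y z : host_vertex n) :
  m <= x.2 -> m <= y.2 -> m <= z.2 ->
  adj G x y -> adj G x z -> adj G y z -> x.2 < m + t.
Proof.
move=> xm ym zm; rewrite !adjG !layeredE.
move=> /and3P[_ _ xy] /and3P[_ _ xz] /and3P[_ _ yz].
move: xy xz yz; rewrite !ltnNge xm ym zm /= -!ltnNge.
case/orP=> [/andP[] // | Qxy]; case/orP=> [/andP[] // | Qxz].
have [_ y_rest _] := rest_out restQ Qxy.
rewrite [y.2 < _]ltnNge y_rest /= => Qyz.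
by have := rest_triangle_free restQ Qxy Qyz; rewrite Qxz.
Qed.

Lemma layered_free : ~~ contains (K3part (m + d) m m) G.
Proof.
apply/negP => /(K3part_copy layered_partite).
case=> // [|A [B [C [[cA cB cC] [[A1 B1 C1] [AB AC BC]]]]]]; first lia.
have part_of X : one_coloured (fun x : host_vertex n => x.1) X -> 0 < #|X| ->
    exists i, in_part i X.
  move=> X1; rewrite card_gt0 => /set0Pn[x xX]; exists x.1 => y yX; exact: X1.
have [a Aa] := part_of A A1 ltac:(lia).
have [b Bb] := part_of B B1 ltac:(lia).
have [c Cc] := part_of C C1 ltac:(lia).
have high_or_low (X : {set host_vertex n}) :
    (forall x, x \in X -> x.2 < m) \/ exists2 x, x \in X & m <= x.2.
  have [/forall_inP|/forall_inPn[x xX]] := boolP [forall x in X, x.2 < m].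
    by left.
  by rewrite -leqNgt; right; exists x.
have [C_low|[z zC z_high]] := high_or_low C.
  by apply: (no_joined_to_bottom Aa Bb Cc) C_low => //; lia.
have [B_low|[y yB y_high]] := high_or_low B.
  by apply: (no_joined_to_bottom Aa Cc Bb) B_low => //;
    [lia | lia | lia | exact: completely_joinedC].
have [A_low|[x xA x_high]] := high_or_low A.
  (* Here [m + d <= m], so that [B] is as large as [A] and can take its role. *)
  have /subset_leq_card : A \subset block n a 0 m.
    by apply/subsetP => x xA; rewrite inE (Aa _ xA) eqxx A_low.
  rewrite card_block => [cAm|]; last lia.
  apply: (no_joined_to_bottom Bb Cc Aa) A_low => //; try lia;
    exact: completely_joinedC.
have A_mid u : u \in A -> u.2 < m + t.
  move=> uA; have [u_low|u_high] := ltnP u.2 m; first lia.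
  by apply: (high_triangle u_high y_high z_high); auto.
have /subset_leq_card : A \subset block n a 0 (m + t).
  by apply/subsetP => u uA; rewrite inE (Aa _ uA) eqxx A_mid.
rewrite card_block; last lia.
by have := A_mid _ xA; lia.
Qed.

Lemma bottom_adj (x y : host_vertex n) : x.1 != y.1 -> (0 < x.2) || (0 < y.2) ->
  (x.2 < m) || (y.2 < m) -> adj G x y.
Proof. by rewrite adjG layeredE => -> -> /orP[]->; rewrite ?orbT. Qed.

Lemma copy_at_origins (x y : host_vertex n) :
  x.1 != y.1 -> x.2 = 0 :> nat -> y.2 = 0 :> nat ->
  contains (K3part (m + d) m m) (add_edge G [set x; y]).
Proof.
move=> xy x0 y0; have [k /andP[kx ky]] := third_part x.1 y.1.
apply: (@contains_K3part _ _
  (block n k 1 n) (block n x.1 0 m) (block n y.1 0 m)).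
- by rewrite card_block //; lia.
- by rewrite card_block //; lia.
- by rewrite card_block //; lia.
- move=> u v; rewrite !inE => /andP[/eqP uk u1] /andP[/eqP vx vm].
  by apply/adj_add_edge/bottom_adj; rewrite ?uk ?vx //; lia.
- move=> u v; rewrite !inE => /andP[/eqP uk u1] /andP[/eqP vx vm].
  by apply/adj_add_edge/bottom_adj; rewrite ?uk ?vx //; lia.
move=> u v; rewrite !inE => /andP[/eqP ux um] /andP[/eqP vy vm].
have [uv0|uv] := boolP ((0 < u.2) || (0 < v.2)).
  by apply/adj_add_edge/bottom_adj; rewrite ?ux ?vy //; lia.
have -> : u = x by apply: host_vertex_eq => //; lia.
have -> : v = y by apply: host_vertex_eq => //; lia.
by apply: adj_added_edge; apply: contraNneq xy => ->.
Qed.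

(** The vertices [x] and [y] replace the origins of their parts, because the
copy uses the origin of the third part. *)
Lemma copy_at_rest (x y : host_vertex n) :
  x.1 != y.1 -> m + t <= x.2 -> m <= y.2 -> ~~ Q x y ->
  contains (K3part (m + d) m m) (add_edge G [set x; y]).
Proof.
move=> xy x_rest y_high nQxy; have [k /andP[kx ky]] := third_part x.1 y.1.
pose N := [set u : host_vertex n | (u.1 == y.1) && Q x u].
have N_high u : u \in N -> m <= u.2.
  by rewrite inE => /andP[_ /(rest_out restQ)[]]; lia.
have yP u : u \in y |: (block n y.1 1 m :|: N) -> u.1 = y.1 /\ 0 < u.2.
  case/setU1P=> [->|/setUP[]]; first by split=> //; lia.
    by rewrite inE => /andP[/eqP-> /andP[]].
  move=> uN; split; last by have := N_high u uN; lia.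
  by move: uN; rewrite inE => /andP[/eqP].
apply: (@contains_K3part _ _ (y |: (block n y.1 1 m :|: N))
  (x |: block n x.1 1 m) (block n k 0 m)).
- rewrite cardsU1 cardsU card_block ?(rest_degree restQ x_rest xy); last lia.
  have -> : block n y.1 1 m :&: N = set0.
    apply/setP => u; rewrite in_set0; apply/negP => /setIP[+ /N_high].
    by rewrite inE; lia.
  have -> : y \notin block n y.1 1 m :|: N.
    by rewrite !inE (negPf nQxy); lia.
  by rewrite cards0; lia.
- rewrite cardsU1 card_block; last lia.
  by rewrite !inE; lia.
- by rewrite card_block; lia.
- move=> u v uP; rewrite in_setU1.
  have [uy u0] := yP u uP.
  case/predU1P=> [->|].
    case/setU1P: uP => [->|].
      by rewrite adj_sym adj_added_edge //; apply: contraNneq xy => ->.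
    move=> uP; apply: adj_add_edge; rewrite adj_sym; case/setUP: uP.
      by rewrite inE => ?; apply: bottom_adj; rewrite ?uy //; lia.
    by rewrite inE adjG layeredE uy xy u0 => /andP[_ ->]; rewrite !orbT.
  rewrite inE => /andP[/eqP vx v1].
  by apply/adj_add_edge/bottom_adj; rewrite ?uy ?vx 1?eq_sym //; lia.
- move=> u v uP; rewrite inE => /andP[/eqP vk vm].
  have [uy u0] := yP u uP.
  by apply/adj_add_edge/bottom_adj; rewrite ?uy ?vk 1?eq_sym //; lia.
move=> u v; rewrite in_setU1 => uP; rewrite inE => /andP[/eqP vk vm].
have [ux u0] : u.1 = x.1 /\ 0 < u.2.
  case/predU1P: uP => [->|]; first by split=> //; lia.
  by rewrite inE => /andP[/eqP-> /andP[]].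
by apply/adj_add_edge/bottom_adj; rewrite ?ux ?vk 1?eq_sym //; lia.
Qed.

Lemma layered_saturated : saturated (host n) (K3part (m + d) m m) G.
Proof.
apply/and3P; split; last 1 first.
- apply/forall_inP => e; rewrite inE => /andP[eG /edge_adj[x [y [eE]]]].
  rewrite adj_multipartite => xy; move: eG; rewrite {e}eE.
  change ([set x; y] \in edges G) with (adj G x y); rewrite adjG layeredE xy /=.
  rewrite negb_and !negb_or -!leqNgt !leqn0.
  case/orP=> [/andP[/eqP x0 /eqP y0]|/and4P[xm ym xyt nQ]].
    exact: copy_at_origins.
  have [x_rest|x_mid] := leqP (m + t) x.2; first exact: copy_at_rest.
  rewrite setUC; apply: copy_at_rest => //; first by rewrite eq_sym.
    by move: xyt; rewrite x_mid -leqNgt.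
  by rewrite (rest_sym restQ).
- by apply: edges_subset => x y /layered_partite; rewrite adj_multipartite.
- exact: layered_free.
Qed.

End Layered.

(** * Number of edges *)

Lemma neq_ordS (i j : 'I_3) : (i != j) = (j == ordS i) || (i == ordS j).
Proof. by case: i j => [[|[|[|//]]] ?] [[|[|[|//]]] ?]; rewrite -!val_eqE. Qed.

Lemma ordSS_eq (i j : 'I_3) : (j == ordS (ordS i)) = (i == ordS j).
Proof. by case: i j => [[|[|[|//]]] ?] [[|[|[|//]]] ?]; rewrite -!val_eqE. Qed.

Lemma ordS_asym (i : 'I_3) : (i == ordS (ordS i)) = false.
Proof. by case: i => [[|[|[|//]]] ?]; rewrite -!val_eqE. Qed.

Lemma ordS_neq (i : 'I_3) : (i == ordS i) = false.
Proof. by case: i => [[|[|[|//]]] ?]; rewrite -!val_eqE. Qed.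

Section EdgeCount.

Variables (n m t d : nat) (Q : rel (host_vertex n)).
Variable G : sgraph (host_vertex n).
Hypotheses (m_gt0 : 0 < m) (mtn : m + t <= n).
Hypotheses (restQ : rest (m + t) d Q) (adjG : adj G =2 layered m t Q).

(** The number of neighbours of the [k]-th vertex of a part in each of the two
other parts. *)
Let degree_bound k :=
  if k == 0 then n.-1 else if k < m then n
  else if k < m + t then m + t else m + d.

Lemma layered_degree (x : host_vertex n) j : x.1 != j ->
  #|[set y : host_vertex n | (y.1 == j) && adj G x y]| <= degree_bound x.2.
Proof.
move=> xj; pose A := [set y : host_vertex n | (y.1 == j) && adj G x y].
rewrite /degree_bound; have [x0|x_gt0] := eqVneq (x.2 : nat) 0.
  have /subset_leq_card : A \subset block n j 1 n.
    apply/subsetP => y; rewrite !inE => /andP[-> /=].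
    rewrite adjG layeredE x0 ltn_ord andbT.
    by case/and3P.
  by move/leq_trans; apply; rewrite card_block // subn1.
have [x_low|x_high] := ltnP x.2 m.
  have /subset_leq_card : A \subset block n j 0 n.
    by apply/subsetP => y; rewrite !inE => /andP[->]; rewrite ltn_ord.
  by rewrite card_block // subn0.
have [x_mid|x_rest] := ltnP x.2 (m + t).
  have /subset_leq_card : A \subset block n j 0 (m + t).
    apply/subsetP => y; rewrite !inE => /andP[-> /=]; rewrite adjG layeredE.
    case/and3P => _ _; rewrite x_mid (ltnNge x.2) x_high /=.
    by case/or3P => [|//|/(rest_out restQ)[]]; lia.
  by rewrite card_block // subn0.
pose N := [set y : host_vertex n | (y.1 == j) && Q x y].
have /subset_leq_card : A \subset block n j 0 m :|: N.
  apply/subsetP => y; rewrite !inE => /andP[-> /=]; rewrite adjG layeredE.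
  by case/and3P => _ _; rewrite !(ltnNge x.2) x_high x_rest.
move/leq_trans; apply; apply: leq_trans (leq_card_setU _ _) _.
by rewrite card_block ?(rest_degree restQ) ?subn0 //; lia.
Qed.

Lemma sum_degree_bound :
  \sum_(k < n) degree_bound k =
  n.-1 + m.-1 * n + t * (m + t) + (n - (m + t)) * (m + d).
Proof.
rewrite -(big_mkord xpredT degree_bound) /degree_bound.
rewrite (big_cat_nat (leq0n (m + t)) mtn) /=.
rewrite (big_cat_nat (leq0n m) (leq_addr t m)) /=.
rewrite (big_cat_nat (leq0n 1) m_gt0) big_nat1 /=.
have const a b c : (forall k, a <= k < b -> degree_bound k = c) ->
    \sum_(a <= k < b) degree_bound k = (b - a) * c.
  by move=> Fc; rewrite (eq_big_nat _ _ (F2 := fun=> c) Fc) sum_nat_const_nat.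
rewrite (const 1 m n) ?(const m (m + t) (m + t)) ?(const (m + t) n (m + d)).
- by rewrite subn1 addKn.
- by move=> k kP; rewrite /degree_bound; repeat case: ifP => ?; lia.
- by move=> k kP; rewrite /degree_bound; repeat case: ifP => ?; lia.
- by move=> k kP; rewrite /degree_bound; repeat case: ifP => ?; lia.
Qed.

(** Each edge runs from some part to its cyclic successor, so the degrees into
the next part bound the number of edges. *)
Lemma layered_edges :
  #|edges G| <= 3 * (n.-1 + m.-1 * n + t * (m + t) + (n - (m + t)) * (m + d)).
Proof.
pose arcs := [set p : host_vertex n * host_vertex n |
  (p.2.1 == ordS p.1.1) && adj G p.1 p.2].
have /subset_leq_card : edges G \subset [set [set p.1; p.2] | p in arcs].
  apply/subsetP => e /edge_adj[x [y [-> xy]]].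
  have: x.1 != y.1 by move: xy; rewrite adjG layeredE => /andP[].
  rewrite neq_ordS => /orP[yS|xS]; apply/imsetP.
    by exists (x, y); rewrite // inE yS.
  by exists (y, x); rewrite 1?setUC // inE xS adj_sym.
move/leq_trans; apply; apply: leq_trans (leq_imset_card _ _) _.
rewrite cardsE -sum1_card -(pair_big_dep xpredT
  (fun x y : host_vertex n => (y.1 == ordS x.1) && adj G x y)
  (fun _ _ => 1)) /=.
have degE (x : host_vertex n) :
    \sum_(y : host_vertex n | (y.1 == ordS x.1) && adj G x y) 1 <=
    degree_bound x.2.
  by rewrite sum1dep_card layered_degree // neq_ordS eqxx.
apply: leq_trans (leq_sum _ (fun x _ => degE x)) _.
rewrite -(pair_big xpredT xpredT
  (fun (i : 'I_3) (k : 'I_n) => degree_bound k)) /=.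
by rewrite sum_nat_const card_ord sum_degree_bound.
Qed.

End EdgeCount.

(** * Existence of the triangle-free rest *)

Section Circulant.
Import GRing.Theory.
Local Open Scope ring_scope.

(** In part [i], each [a] is joined to the elements [a + u] of the next part,
with [u] in [D i]. A triangle visits the three parts in cyclic order, in one of
the two directions, and its three differences sum to zero. *)
Lemma circulant_rest off N d (D : 'I_3 -> {set 'I_N.+1}) :
  (forall i, #|D i| = d) ->
  (forall i a b c, a \in D i -> b \in D (ordS i) -> c \in D (ordS (ordS i)) ->
     a + b + c != 0) ->
  exists Q : rel (host_vertex (off + N.+1)), rest off d Q.
Proof.
move=> D_card D_sum.
pose R (i j : 'I_3) (a b : 'I_N.+1) :=
  ((j == ordS i) && (b - a \in D i)) || ((i == ordS j) && (a - b \in D j)).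
pose Q : rel (host_vertex (off + N.+1)) := fun x y =>
  if (split x.2, split y.2) is (inr a, inr b) then R x.1 y.1 a b else false.
have shiftE a : split (rshift off a) = inr a :> 'I_off + 'I_N.+1.
  exact: unsplitK (inr a).
have QP x y : Q x y -> exists a b,
    [/\ x.2 = rshift off a, y.2 = rshift off b & R x.1 y.1 a b].
  rewrite /Q; case: split_ordP => // a xa; case: split_ordP => // b yb Rab.
  by exists a, b.
exists Q; split.
- move=> x y; rewrite /Q; case: split => // a; case: split => // b.
  by rewrite /R orbC.
- move=> x y /QP[a [b [-> -> Rab]]]; rewrite !leq_addr; split => //.
  rewrite neq_ordS; move: Rab; rewrite /R.
  by case/orP=> /andP[->]; rewrite ?orbT.
- move=> x y z /QP[a [b [xa yb Rxy]]] /QP[b' [c [yb' zc Ryz]]].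
  have bb : b' = b by apply: (@rshift_inj off); rewrite -yb.
  subst b'; apply/negP => /QP[a' [c' [xa' zc' Rxz]]].
  have aa : a' = a by apply: (@rshift_inj off); rewrite -xa.
  have cc : c' = c by apply: (@rshift_inj off); rewrite -zc.
  subst a' c'; move: Rxy Ryz Rxz; rewrite /R.
  move: (x.1) (y.1) (z.1) => i j k.
  have closed i' u v w : v - u \in D i' -> w - v \in D (ordS i') ->
      u - w \in D (ordS (ordS i')) -> False.
    move=> uv vw wu; have := D_sum _ _ _ _ uv vw wu.
    by rewrite (addrC (v - u)) !addrA !subrK subrr eqxx.
  have S1 i' : ordS i' <> i' :> 'I_3 by apply/eqP; rewrite eq_sym ordS_neq.
  have S2 i' : ordS (ordS i') <> i' :> 'I_3.
    by apply/eqP; rewrite eq_sym ordS_asym.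
  have P1 (i' : 'I_3) : ord_pred (ordS i') = i' by apply: ordSK.
  move: (S1 i) (S1 j) (S1 k) (S2 i) (S2 j) (S2 k) (P1 i) (P1 j) (P1 k).
  move=> Si Sj Sk SSi SSj SSk Pi Pj Pk.
  case/orP=> /andP[/eqP ij ab]; case/orP=> /andP[/eqP jk bc];
    case/orP=> /andP[/eqP ik ac]; try congruence.
  + by rewrite jk ij in ac; rewrite ij in bc; apply: closed ab bc ac.
  + by rewrite ij jk in ac; rewrite jk in ab; apply: closed bc ab ac.
move=> x j x_rest xj; have [a xa] : exists a, x.2 = rshift off a.
  case: (split_ordP x.2) x_rest => a xa; last by exists a.
  by rewrite xa /= leqNgt ltn_ord.
pose S := [set b | R x.1 j a b].
have -> : [set y : host_vertex (off + N.+1) | (y.1 == j) && Q x y] =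
    [set (j, rshift off b) | b in S].
  apply/setP => y; rewrite inE; apply/andP/imsetP => [[/eqP yj]|[b]].
    case/QP => a' [b [xa' yb]].
    have -> : a' = a by apply: (@rshift_inj off); rewrite -xa.
    rewrite yj => Rab; exists b; first by rewrite inE.
    by rewrite [y]surjective_pairing yj yb.
  by rewrite inE => Rab ->; rewrite /= /Q xa !shiftE.
rewrite card_imset; last by move=> b b' [] /addnI/val_inj.
have [jS|iS] : j = ordS x.1 \/ x.1 = ordS j.
  by move: xj; rewrite neq_ordS => /orP[]/eqP; [left | right].
- have -> : S = (fun b : 'I_N.+1 => b - a) @^-1: D x.1.
    by apply/setP => b; rewrite !inE /R jS eqxx ordS_asym orbF.
  by rewrite card_preimset //; apply: addIr.
have -> : S = (fun b : 'I_N.+1 => a - b) @^-1: D j.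
  by apply/setP => b; rewrite !inE /R iS eqxx ordS_asym.
rewrite card_preimset // => b b' /addrI; exact: oppr_inj.
Qed.

End Circulant.

Lemma progression_rest n off d q :
  off < n -> 0 < q -> q * d <= n - off ->
  (forall k, k + 2 < 3 * d -> ~~ (n - off %| q * k + 1)) ->
  exists Q : rel (host_vertex n), rest off d Q.
Proof.
move=> off_n q_gt0; have -> : n = off + (n - off).-1.+1 by lia.
rewrite addKn; move: (n - off).-1 => N {n off_n} qdN sumN.
pose c (i : 'I_3) := nat_of_bool (i == 2 :> nat).
pose D (i : 'I_3) : {set 'I_N.+1} := [set inZp (q * s + c i) | s : 'I_d].
apply: (@circulant_rest off N d D) => [i | i _ _ _
    /imsetP[s _ ->] /imsetP[s' _ ->] /imsetP[s'' _ ->]].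
  rewrite card_imset ?card_ord // => s s' /(congr1 val) /= /eqP.
  rewrite eqn_modDr => /eqP; have lt_qN (k : 'I_d) : q * k < N.+1.
    by apply: leq_trans qdN; rewrite ltn_pmul2l.
  by rewrite !modn_small // => /eqP; rewrite eqn_pmul2l // => /eqP/val_inj.
have -> : (inZp (q * s + c i) + inZp (q * s' + c (ordS i))
    + inZp (q * s'' + c (ordS (ordS i)))
    = inZp (q * (s + s' + s'') + 1) :> 'I_N.+1)%R.
  apply: val_inj; rewrite /=.
  rewrite modnDm -addnA modnDml addnCA modnDml; congr (_ %% _).
  have : c i + c (ordS i) + c (ordS (ordS i)) = 1.
    by rewrite /c; case: i => [[|[|[|//]]] ?].
  by move: (c i) (c _) (c _) => c0 c1 c2 cE; rewrite !mulnDr; lia.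
rewrite -val_eqE /=; apply: sumN.
by have := ltn_ord s; have := ltn_ord s'; have := ltn_ord s''; lia.
Qed.

(** The conclusion [t * (d - t) = d./2 * (d - d./2)] says that the choice of
[t] does not change the number of edges. It allows [t] to be [ceil (d / 2)],
which is taken when [d] is odd and exactly [3 * d - 2] rest vertices would be
left by [floor (d / 2)]. *)
Lemma exists_rest n m d :
  0 < m -> m + d + 2 <= n -> m + d./2 + 3 * d - 2 <= n ->
  exists t, [/\ 0 < t -> t < d, m + t <= n,
    t * (d - t) = d./2 * (d - d./2) &
    exists Q : rel (host_vertex n), rest (m + t) d Q].
Proof.
move=> m_gt0 n_ge n_ge'; have d2 := odd_double_half d; rewrite -muln2 in d2.
have [n_large|n_small] := leqP (3 * d) (n - (m + d./2) + 1).
  exists d./2; split; try lia.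
  apply: (@progression_rest _ _ _ 1); try lia.
  by move=> k kd; rewrite gtnNdvd //; lia.
have nE : n - (m + d./2) = 3 * d - 2 by lia.
have [d_odd|d_even] := boolP (odd d).
  have d_ge3 : 3 <= d by case: (d) d_odd n_small nE n_ge => [|[|[|]]] //=; lia.
  exists d./2.+1; split; try lia.
  by apply: (@progression_rest _ _ _ 2); lia.
exists d./2; split; try lia.
by apply: (@progression_rest _ _ _ 2); lia.
Qed.

(** * The construction is layered *)

Lemma mem_cyclic_join n a b (x y : host_vertex n) :
  ([set x; y] \in \bigcup_i join (block n i a b) (block n (ordS i) a b)) =
  [&& x.1 != y.1, a <= x.2 < b & a <= y.2 < b].
Proof.
apply/bigcupP/idP => [[i _]|].
  rewrite mem_join !inE.
  case/orP=> /andP[/andP[/eqP-> ->] /andP[/eqP-> ->]];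
    by rewrite ?andbT neq_ordS eqxx ?orbT.
case/and3P; rewrite neq_ordS => /orP[] /eqP E xab yab;
  [exists x.1 | exists y.1] => //;
  by rewrite mem_join !inE E xab yab !eqxx ?orbT.
Qed.

Lemma mem_bottom_join n m (x y : host_vertex n) :
  ([set x; y] \in \bigcup_i join (block n i 0 m)
     (block n (ordS i) 0 n :|: block n (ordS (ordS i)) 0 n)) =
  (x.1 != y.1) && ((x.2 < m) || (y.2 < m)).
Proof.
have other (i j : 'I_3) : (i != j) = (j == ordS i) || (j == ordS (ordS i)).
  by rewrite ordSS_eq neq_ordS.
apply/bigcupP/idP => [[i _]|].
  rewrite mem_join !inE !leq0n !ltn_ord !andbT /= -!other.
  case/orP=> /andP[].
    by case/andP=> /eqP-> -> ->.
  by move=> ix /andP[/eqP-> ->]; rewrite eq_sym ix orbT.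
case/andP=> xy /orP[xm|ym]; [exists x.1 | exists y.1] => //;
  rewrite mem_join !inE !leq0n !ltn_ord !andbT /= -!other ?xm ?ym eqxx ?xy //.
by rewrite (eq_sym y.1) xy !orbT.
Qed.

Lemma C4_rest_adj n m d Q : C4_rest (m + d) m Q -> @rest n (m + d./2) d (adj Q).
Proof.
rewrite /C4_rest addKn => -[Q_host Q_rest /forallP Q_free Q_deg].
have in_rest x y : adj Q x y -> m + d./2 <= x.2.
  by move/Q_rest => /bigcupP[i _]; rewrite inE => /and3P[].
have host_neq x y : adj Q x y -> x.1 != y.1.
  move/(subsetP Q_host); rewrite -[_ \in _]/(adj (host n) x y).
  by rewrite adj_multipartite.
split.
- exact: adj_sym.
- move=> x y xy; split; [exact: in_rest xy | | exact: host_neq].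
  by apply: (in_rest y x); rewrite adj_sym.
- move=> x y z xy yz; apply/negP => xz.
  by have /forallP/(_ y)/forallP/(_ z) := Q_free x; rewrite xy yz xz.
move=> x j x_rest xj; have xR : x \in block n x.1 (m + d./2) n.
  by rewrite inE eqxx x_rest ltn_ord.
have [deg1 deg2] := Q_deg x.1 x xR.
have inR i : [set y in block n i (m + d./2) n | adj Q x y] =
    [set y : host_vertex n | (y.1 == i) && adj Q x y].
  apply/setP => y; rewrite !inE ltn_ord andbT.
  have [Qxy|] := boolP (adj Q x y); last by rewrite !andbF.
  by rewrite (in_rest y x) ?andbT // adj_sym.
rewrite !inR in deg1 deg2.
by move: xj; rewrite neq_ordS -(ordSS_eq x.1) => /orP[]/eqP->.
Qed.

Lemma C4_layered n m d (G : sgraph (host_vertex n)) :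
  C4 (m + d) m G ->
  exists2 Q, rest (m + d./2) d Q & adj G =2 layered m d./2 Q.
Proof.
case=> Q /C4_rest_adj restQ; rewrite addKn => edgesG; exists (adj Q) => // x y.
have adjE (H : sgraph (host_vertex n)) :
  ([set x; y] \in edges H) = adj H x y by [].
rewrite -adjE edgesG in_setD !in_setU !mem_cyclic_join mem_bottom_join.
rewrite adjE layeredE.
have [Qxy|_] := boolP (adj Q x y).
  have [_ _ ->] := rest_out restQ Qxy.
  by rewrite !orbT !andbT /= negb_and -!leqNgt.
by case: (x.1 != y.1) => //=; lia.
Qed.

(** If every vertex had [m + d] neighbours in the next
part, the count would be [3 * (m + d) * n]; the low vertices have [n - m - d]
more each, the middle ones [d - t] less, and each origin has one less. *)
Lemma edge_count n m t d :
  0 < m -> (0 < t -> t < d) -> m + t <= n ->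
  3 * (n.-1 + m.-1 * n + t * (m + t) + (n - (m + t)) * (m + d)) =
  3 * (m + d + m) * n - 3 * (t * (d - t)) - 3 * (m + d) * m - 3.
Proof.
move=> m_gt0 td mtn.
have [k mE] : exists k, m = k.+1 by exists m.-1; lia.
have [N nE] : exists N, n = m + t + N by exists (n - (m + t)); lia.
have [s dE] : exists s, d = t + s by exists (d - t); lia.
by subst d n m; rewrite !addKn /=; lia.
Qed.

Theorem theorem3 (l m n : nat) (l_gt0 : 0 < l) (m_gt0 : 0 < m) (le_ml : m <= l)
    (n_ge : maxn (l + 2) (3 * l + (l - m)./2 - 2 * m - 2) <= n) :
  (forall G : sgraph (host_vertex n),
     C4 l m G -> saturated (host n) (K3part l m m) G) /\
  sat (host n) (K3part l m m) <=
    3 * (l + m) * n - 3 * (l - m - (l - m)./2) * (l - m)./2 - 3 * l * m - 3.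
Proof.
have [d lE] : exists d, l = m + d by exists (l - m); lia.
subst l; rewrite addKn in n_ge *.
have d2 := odd_double_half d; rewrite -muln2 in d2.
have mdn : m + d < n by lia.
split=> [G /C4_layered[Q restQ adjG]|].
  by apply: layered_saturated m_gt0 mdn _ restQ adjG; lia.
have [||t [td mtn tE [Q restQ]]] := @exists_rest n m d m_gt0; try lia.
pose G := rel_graph (layered m t Q).
have adjG : adj G =2 layered m t Q.
  move=> x y; rewrite adj_rel_graph; last first.
    move=> u v; rewrite /layered /= eq_sym orbC (rest_sym restQ).
    by congr [&& _, _ & _]; rewrite orbCA [(v.2 < m + t) && _]andbC.
  by rewrite andb_idl // => /and3P[+ _ _]; apply: contraNneq => ->.
apply: leq_trans (sat_le (layered_saturated m_gt0 mdn td restQ adjG)) _.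
apply: leq_trans (layered_edges m_gt0 mtn restQ adjG) _.
rewrite -(mulnA 3 (d - _)) [_ * d./2]mulnC -tE.
by rewrite edge_count.
Qed.
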